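(* Let $S$ be a set. If $K_1,K_2$ are isomorphism classes of finite simplicial complexes over $S$, then $d(K_1,K_2)\in\mathbf{Q}$.
   Context: $\mathcal{P}_f^*(S)$ is the collection of all non-empty finite subsets of $S$. A simplicial complex over $S$ is a non-empty collection $\mathcal{K}\subset\mathcal{P}_f^*(S)$ such that every non-empty subset of an element of $\mathcal{K}$ belongs to $\mathcal{K}$; it is finite if it has finitely many elements. $\Omega=[0,1]$ with Lebesgue measure $\lambda$. $L(\mathcal{K})$ is the set of measurable maps $f:\Omega\to S$, identified when equal almost everywhere, such that $f(\Omega)\in\mathcal{K}$, where $f(\Omega)$ denotes the set $\{s\in S : \lambda(f^{-1}(s))>0\}$ and $f$ takes its values in this set almost everywhere. The metric is $d(f,g)=\lambda(\{t\in\Omega : f(t)\neq g(t)\})$. The distance between simplicial complexes is the Hausdorff distance $d(\mathcal{K}_1,\mathcal{K}_2)=\max(\delta(\mathcal{K}_1,\mathcal{K}_2),\delta(\mathcal{K}_2,\mathcal{K}_1))$ with $\delta(\mathcal{K}_1,\mathcal{K}_2)=\sup_{f\in L(\mathcal{K}_1)}\inf_{g\in L(\mathcal{K}_2)}d(f,g)$. Let $\mathfrak{S}(S)$ be the group of all permutations of $S$, acting on simplicial complexes by $\sigma(\mathcal{K})=\{\sigma(F):F\in\mathcal{K}\}$. An isomorphism class is an orbit of this action, and $d(K_1,K_2)=\inf_{\mathcal{K}_1\in K_1,\,\mathcal{K}_2\in K_2}d(\mathcal{K}_1,\mathcal{K}_2)=\inf_{\sigma\in\mathfrak{S}(S)}d(\mathcal{K}_1,\sigma(\mathcal{K}_2))$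 for any fixed representatives in the last expression. *)

(* Defs.v *)
From HB Require Import structures.
From mathcomp Require Import all_boot all_order all_algebra.
From mathcomp Require Import all_classical all_reals all_analysis.

Set Implicit Arguments.
Unset Strict Implicit.
Unset Printing Implicit Defensive.

Import Order.TTheory GRing.Theory Num.Theory.
Local Open Scope classical_set_scope.
Local Open Scope ring_scope.
Local Open Scope ereal_scope.

Section simplicial_complexes.
Context {S : Type}.
Implicit Types (K : set (set S)) (F G : set S) (s : S -> S).

(* A collection of simplices is any [K : set (set S)]; the members of [K] are
   its (non-empty, finite) simplices. *)
Definition simplicial_complex K :=
  [/\ K !=set0,
      forall F, K F -> finite_set F /\ F !=set0
    & forall F G, K F -> G `<=` F -> G !=set0 -> K G].

Definition perm_complex s K : set (set S) := [set s @` F | F in K].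

Definition iso_class K : set (set (set S)) :=
  [set perm_complex s K | s in [set s : S -> S | bijective s]].

Definition is_finite_iso_class (C : set (set (set S))) :=
  exists K, [/\ simplicial_complex K, finite_set K & C = iso_class K].

End simplicial_complexes.

Section distances.
Context {R : realType} {S : Type}.

(* The real line with its Lebesgue (i.e. completed Borel) sigma-algebra: this is
   the measurable type that carries [completed_lebesgue_measure]. *)
Definition lebesgue_line (R : realType) :=
  caratheodory_type ((wlength (idfun : R -> R))^*)%mu.

Local Notation lambda := (@completed_lebesgue_measure R).

Definition Omega : set (lebesgue_line R) := `[0%R, 1%R]%classic.

Implicit Types (f g : lebesgue_line R -> S) (K : set (set S)).

(* Only the values of [f] on [Omega] matter. This is [measurable_fun Omega f]
   unfolded, [S] being equipped with the sigma-algebra of all its subsets. *)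
Definition measurable_map f := forall A : set S, measurable (Omega `&` f @^-1` A).

Definition ess_image f : set S :=
  [set s | 0 < lambda (Omega `&` f @^-1` [set s])].

(* Representatives of the elements of L(K). Maps that are equal almost
   everywhere have the same essential image and the same distances to all other
   maps, so passing to classes does not change the sup and inf below. *)
Definition L K : set (lebesgue_line R -> S) :=
  [set f | [/\ measurable_map f,
               K (ess_image f)
             & {ae lambda, forall t, Omega t -> ess_image f (f t)}]].

Definition dist_map f g : \bar R := lambda (Omega `&` [set t | f t <> g t]).

Definition delta K1 K2 : \bar R :=
  ereal_sup [set ereal_inf [set dist_map f g | g in L K2] | f in L K1].

Definition dist_complex K1 K2 : \bar R :=
  Order.max (delta K1 K2) (delta K2 K1).

Definition dist_class (C1 C2 : set (set (set S))) : \bar R :=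
  ereal_inf [set dist_complex K1 K2 | K1 in C1 & K2 in C2].

End distances.

Arguments dist_class R {S} C1 C2.

(* Main.v *)
Require Import Defs.
From mathcomp Require Import all_boot all_order all_algebra.
From mathcomp Require Import all_classical all_reals all_analysis.
From mathcomp Require Import lra.

(** Let [K] be a finite complex and [K'] any complex. For [f] in [L K], the maps of
[L K'] with essential image inside a simplex [G] of [K'] are at distance at
least [lambda (f \notin G)] from [f], and this bound is reached by the map
equal to [f] where [f] lies in [G] and constant elsewhere ([exists_near_map],
[le_dist_map]). Hence the distance from [f] to [L K'] is the minimum over [G]
of [lambda (f \notin G)], which depends on [f] only through its law, a
probability vector on the vertices of a simplex of [K] ([law_prob],
[lambda_outside]). Every probability vector is a law, as one sees by cutting
[0, 1] into intervals ([exists_map_of_prob]). So [delta K K'] is the maximum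
over the simplices [A] of [K] of
  max over probability vectors [p] on [A] of
  min over the simplices [G] of [K'] of p (A \ G),
and each inner term is the value of a matrix game with 0-1 entries.

The value of such a game is the optimum of a linear program with rational
coefficients. Fourier-Motzkin elimination of the unknown probabilities
([eliminate_variables]) leaves finitely many rational linear inequalities in
the value alone, so the optimum is attained and rational
([rational_max_line], [rational_game_value]).

It remains to take the infimum over two isomorphism classes, which may be
infinite when [S] is. The vertices of a finite complex are labelled by some
ordinal ['I_n], and relabelling by a permutation of [S] does not change the
combinatorial pattern [k : {set {set 'I_n}}]. With [k] fixed, the game depends
on [K'] only through the family of traces of its simplices on the vertices of
[K], an element of the finite type [{set {set 'I_n}}] ([delta_rational]).
Thus the distance takes finitely many values, all rational, over the two
classes, and the infimum is a minimum ([ereal_inf_rational_values]). *)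

Set Implicit Arguments.
Unset Strict Implicit.
Unset Printing Implicit Defensive.

Import Order.TTheory GRing.Theory Num.Theory.
Local Open Scope classical_set_scope.
Local Open Scope ring_scope.

(** * Linear programs with rational coefficients *)

Section rational_linear_programming.
Context {R : realType}.
Implicit Types (x y : nat -> R) (c : {poly rat}) (cs : seq {poly rat}).

(** A rational linear form in countably many unknowns is encoded by a polynomial,
used only as a finitely supported sequence of coefficients; [n] truncates it to
the first [n] unknowns. Affine forms are obtained by setting the unknown of
index 0 to 1. *)
Definition linform n c x : R := \sum_(i < n) ratr c`_i * x i.

Lemma linformD n c c' x : linform n (c + c') x = linform n c x + linform n c' x.
Proof.
by rewrite /linform -big_split; apply: eq_bigr => i _ /=; rewrite coefD rmorphD mulrDl.
Qed.

Lemma linformZ n a c x : linform n (a *: c) x = ratr a * linform n c x.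
Proof.
by rewrite /linform big_distrr; apply: eq_bigr => i _ /=; rewrite coefZ rmorphM mulrA.
Qed.

Lemma linformN n c x : linform n (- c) x = - linform n c x.
Proof. by rewrite -scaleN1r linformZ rmorphN rmorph1 mulN1r. Qed.

Lemma linform_sum n (I : Type) (r : seq I) (P : pred I) (F : I -> {poly rat}) x :
  linform n (\sum_(i <- r | P i) F i) x = \sum_(i <- r | P i) linform n (F i) x.
Proof.
apply: (big_morph (fun c => linform n c x) (fun c c' => linformD n c c' x)).
by rewrite /linform big1 // => i _; rewrite coef0 rmorph0 mul0r.
Qed.

Lemma linformX n j x : (j < n)%N -> linform n 'X^j x = x j.
Proof.
move=> ltjn; rewrite /linform (bigD1 (Ordinal ltjn)) //= coefXn eqxx rmorph1.
rewrite mul1r big1 ?addr0 // => i; rewrite -val_eqE /= coefXn => /negbTE ->.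
by rewrite rmorph0 mul0r.
Qed.

Lemma eq_linform n c x y :
  (forall i, (i < n)%N -> x i = y i) -> linform n c x = linform n c y.
Proof. by move=> xy; apply: eq_bigr => i _; rewrite xy. Qed.

Definition sat n cs x := {in cs, forall c, linform n c x <= 0}.

Lemma exists_between (lo up : seq R) :
  {in lo & up, forall l u, l <= u} ->
  exists y : R, {in lo, forall l, l <= y} /\ {in up, forall u, y <= u}.
Proof.
elim: lo => [_|l lo IH lou].
  elim: up => [|u up [y [_ yup]]]; first by exists 0.
  exists (Num.min u y); split=> // v; rewrite inE => /predU1P[->|/yup yv].
    by rewrite ge_min lexx.
  by rewrite ge_min yv orbT.
have [|y [loy yup]] := IH.
  by move=> a b alo bup; apply: lou; rewrite // inE alo orbT.
exists (Num.max l y); split=> [a|u uup].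
  rewrite inE => /predU1P[->|/loy ay]; first by rewrite le_max lexx.
  by rewrite le_max ay orbT.
by rewrite ge_max yup // lou // mem_head.
Qed.

(** One Fourier-Motzkin step: the constraints in which the last unknown has a
positive (resp. negative) coefficient bound it from above (resp. below), and an
admissible value exists iff each lower bound is at most each upper bound. Such
a comparison, cleared of denominators, is again a rational linear inequality. *)
Lemma eliminate_variable n cs :
  exists cs', forall x,
    (exists y : R, sat n.+1 cs (fun i => if i == n then y else x i)) <-> sat n cs' x.
Proof.
pose up := [seq c : {poly rat} <- cs | 0 < c`_n]; pose lo := [seq c : {poly rat} <- cs | c`_n < 0].
pose free := [seq c : {poly rat} <- cs | c`_n == 0].
exists (free ++ [seq a`_n *: b - b`_n *: a | b : {poly rat} <- lo, a : {poly rat} <- up]) => x.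
have linformS c (y : R) : linform n.+1 c (fun i => if i == n then y else x i) =
    linform n c x + ratr c`_n * y.
  rewrite /linform big_ord_recr /= eqxx; congr (_ + _).
  by apply: eq_bigr => i _; rewrite (ltn_eqF (ltn_ord i)).
have pairE (a b : {poly rat}) : linform n (a`_n *: b - b`_n *: a) x =
    ratr a`_n * linform n b x - ratr b`_n * linform n a x.
  by rewrite linformD linformN !linformZ.
split=> [[y yP] c|xP].
  rewrite mem_cat => /orP[|/allpairsP[[b a] /= [blo aup ->]]].
    rewrite mem_filter => /andP[/eqP c0 /yP].
    by rewrite linformS c0 rmorph0 mul0r addr0.
  move: blo aup; rewrite !mem_filter => /andP[b0 /yP yb] /andP[a0 /yP ya].
  rewrite pairE; move: yb ya; rewrite !linformS.
  have : 0 < ratr a`_n :> R by rewrite ltr0q.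
  have : ratr b`_n < 0 :> R by rewrite ltrq0.
  by move=> *; nra.
pose bound (c : {poly rat}) : R := - linform n c x / ratr c`_n.
have [|y [loy yup]] := @exists_between (map bound lo) (map bound up).
  move=> _ _ /mapP[b blo ->] /mapP[a aup ->].
  have /xP : a`_n *: b - b`_n *: a \in
      free ++ [seq a`_n *: b - b`_n *: a | b : {poly rat} <- lo, a : {poly rat} <- up].
    by rewrite mem_cat; apply/orP; right; apply/allpairsP; exists (b, a).
  move: blo aup; rewrite pairE !mem_filter => /andP[b0 _] /andP[a0 _].
  have a0' : 0 < ratr a`_n :> R by rewrite ltr0q.
  have b0' : ratr b`_n < 0 :> R by rewrite ltrq0.
  by move=> ab; rewrite /bound ler_pdivlMr // mulrAC ler_ndivrMr //; lra.
exists y => c ccs; rewrite linformS; case: (ltgtP c`_n 0) => c0.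
- have c0' : ratr c`_n < 0 :> R by rewrite ltrq0.
  have /loy : bound c \in map bound lo.
    by apply: map_f; rewrite mem_filter c0.
  by rewrite /bound ler_ndivrMr // -subr_le0 opprK; lra.
- have c0' : 0 < ratr c`_n :> R by rewrite ltr0q.
  have /yup : bound c \in map bound up.
    by apply: map_f; rewrite mem_filter c0.
  by rewrite /bound ler_pdivlMr // -subr_le0; lra.
- rewrite c0 rmorph0 mul0r addr0; apply: xP.
  by rewrite mem_cat mem_filter c0 eqxx ccs.
Qed.

Lemma eliminate_variables m n cs :
  exists cs', forall x,
    (exists y, (forall i, (i < m)%N -> y i = x i) /\ sat (m + n) cs y) <->
    sat m cs' x.
Proof.
elim: n cs => [|n IH] cs.
  exists cs => x; rewrite addn0; split=> [[y [yx yP]]|xP]; last by exists x.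
  by move=> c /yP; rewrite (eq_linform _ yx).
have [cs1 cs1P] := eliminate_variable (m + n) cs.
have [cs2 cs2P] := IH cs1; exists cs2 => x; rewrite addnS -cs2P.
split=> -[y [yx yP]].
  exists y; split=> //; apply/cs1P; exists (y (m + n)%N) => c /yP.
  by congr (_ <= _); apply: eq_linform => i _; case: eqP => // ->.
have [z zP] := (cs1P y).2 yP.
exists (fun i => if i == (m + n)%N then z else y i); split=> // i im.
by rewrite (ltn_eqF (leq_trans im (leq_addr _ _))) yx.
Qed.

Lemma exists_min_seq (q : rat) (s : seq rat) :
  exists2 q0, q0 \in q :: s & {in q :: s, forall r, q0 <= r}.
Proof.
elim: s q => [|r s IH] q.
  by exists q; rewrite ?mem_head // => r; rewrite inE => /eqP ->.
have [q0 q0s q0min] := IH r; case: (leP q q0) => [qq0|q0q].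
  exists q; rewrite ?mem_head // => t; rewrite inE => /predU1P[->//|/q0min].
  exact: le_trans.
exists q0; first by rewrite inE q0s orbT.
by move=> t; rewrite inE => /predU1P[->|/q0min //]; apply: ltW.
Qed.

(** A nonempty upper-bounded set of reals cut out by finitely many rational
affine inequalities is a closed interval (perhaps unbounded below) whose upper
end is the smallest root [- c`_0 / c`_1] of an inequality with positive slope. *)
Lemma rational_max_line cs (P : R -> Prop) (M : R) :
  (forall v, P v <-> sat 2 cs (fun i => if i == 0%N then 1 else v)) ->
  (exists v, P v) -> (forall v, P v -> v <= M) ->
  exists2 q : rat, P (ratr q) & forall v, P v -> v <= ratr q.
Proof.
move=> PE [v0 /PE v0P] PM.
have linform2 c v : linform 2 c (fun i => if i == 0%N then 1 else v) =
    ratr c`_0 + ratr c`_1 * v by rewrite /linform !big_ord_recl big_ord0 mulr1 addr0.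
case E : [seq - c`_0 / c`_1 | c : {poly rat} <- cs & 0 < c`_1] => [|q1 s].
  (* With no inequality of positive slope, all larger values are admissible. *)
  have /PM /= : P (Num.max v0 (M + 1)).
    apply/PE => c ccs; rewrite linform2.
    have c0 : c`_1 <= 0.
      rewrite leNgt; apply/negP => c0.
      suff : - c`_0 / c`_1 \in [seq - c`_0 / c`_1 | c : {poly rat} <- cs & 0 < c`_1].
        by rewrite E.
      by apply: (map_f (fun c : {poly rat} => - c`_0 / c`_1)); rewrite mem_filter c0.
    apply: (le_trans _ (v0P _ ccs)); rewrite linform2 lerD2l.
    by apply: ler_wnM2l; rewrite ?lerq0 // le_max lexx.
  by rewrite ge_max => /andP[_]; rewrite leNgt ltrDl ltr01.
have [q] := exists_min_seq q1 s; rewrite -E => /mapP[c].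
rewrite mem_filter => /andP[c0 ccs] qE qmin.
have le_q v : P v -> v <= ratr q.
  move=> /PE /(_ _ ccs); rewrite linform2 qE => h.
  by rewrite fmorph_div rmorphN ler_pdivlMr ?ltr0q //; lra.
exists q => //; apply/PE => b bcs; rewrite linform2.
case: (ltP 0 b`_1) => b0.
  have /qmin : - b`_0 / b`_1 \in [seq - c`_0 / c`_1 | c : {poly rat} <- cs & 0 < c`_1].
    by apply: (map_f (fun c : {poly rat} => - c`_0 / c`_1)); rewrite mem_filter b0.
  rewrite -(ler_rat R) fmorph_div rmorphN ler_pdivlMr ?ltr0q //; lra.
apply: (le_trans _ (v0P _ bcs)); rewrite linform2 lerD2l.
by apply: ler_wnM2l; rewrite ?lerq0 // le_q //; apply/PE.
Qed.

End rational_linear_programming.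

(** * The value of a matrix game with 0-1 entries *)

Section game_value.
Context {R : realType} {n : nat}.
Implicit Types (A B : {set 'I_n}) (p : 'I_n -> R).

Definition prob_on A p :=
  [/\ forall i, 0 <= p i, forall i, i \notin A -> p i = 0 & \sum_i p i = 1].

Definition mass p B := \sum_(i in B) p i.

(** The maximizing player chooses a point of [A] at random, the opponent a member
of [H], and the first player wins when the point lies outside that member: the
optimal guaranteed winning probability is rational, and attained. *)
Lemma rational_game_value A (H : {set {set 'I_n}}) :
  A != finset.set0 -> H != finset.set0 ->
  exists2 q : rat,
    (exists2 p, prob_on A p & {in H, forall B, ratr q <= mass p (~: B)}) &
    (forall p, prob_on A p -> exists2 B, B \in H & mass p (~: B) <= ratr q).
Proof.
move=> /set0Pn[a0 a0A] /set0Pn[B0 B0H].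
pose P (v : R) := exists2 p, prob_on A p & {in H, forall B, v <= mass p (~: B)}.
pose ind (i : 'I_n) : R := (i == a0)%:R.
have mass_le1 p B : prob_on A p -> mass p B <= 1.
  move=> [p0 _ <-]; rewrite [leRHS](bigID (mem B)) /= lerDl.
  by apply: sumr_ge0.
(* Unknowns 0 and 1 are the homogenizing constant and the guaranteed value [v];
   the probability of [i] is the unknown [i.+2]. *)
pose X (i : 'I_n) : {poly rat} := 'X^(i.+2).
pose cs : seq {poly rat} := [seq - X i | i <- enum 'I_n] ++ [seq X i | i <- enum (~: A)] ++
  [:: \sum_i X i - 1; 1 - \sum_i X i] ++
  [seq 'X - \sum_(i in ~: B) X i | B <- enum H].
have csP y : y 0%N = 1 -> sat (2 + n) cs y <-> prob_on A (fun i => y i.+2) /\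
    {in H, forall B, y 1%N <= mass (fun i : 'I_n => y i.+2) (~: B)}.
  move=> y0; have XE i : linform (2 + n) (X i) y = y i.+2 by rewrite linformX ?add2n ?ltnS ?ltn_ord.
  have oneE : linform (2 + n) 1 y = 1 by rewrite -(expr0 'X) linformX.
  have vE : linform (2 + n) 'X y = y 1%N by rewrite -(expr1 'X) linformX.
  have sumE (Q : pred 'I_n) : linform (2 + n) (\sum_(i | Q i) X i) y =
      \sum_(i | Q i) y i.+2 by rewrite linform_sum; apply: eq_bigr.
  have diffE c c' : linform (2 + n) (c - c') y =
      linform (2 + n) c y - linform (2 + n) c' y by rewrite linformD linformN.
  split=> [yP|[[p0 pA p1] pH] c].
    have p0 (i : 'I_n) : 0 <= y i.+2.
      have /yP : - X i \in cs by rewrite mem_cat (map_f (fun i => - X i)) ?mem_enum.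
      by rewrite linformN XE oppr_le0.
    split; first split=> // [i iA|].
    - apply/eqP; rewrite eq_le p0 andbT -XE; apply: yP.
      by rewrite !mem_cat (map_f X) ?orbT // mem_enum inE.
    - apply/eqP; rewrite eq_le; apply/andP; split.
        have /yP : \sum_i X i - 1 \in cs by rewrite !mem_cat !inE eqxx ?orbT.
        by rewrite diffE sumE oneE subr_le0.
      have /yP : 1 - \sum_i X i \in cs by rewrite !mem_cat !inE eqxx ?orbT.
      by rewrite diffE sumE oneE subr_le0.
    - move=> B BH; have /yP : 'X - \sum_(i in ~: B) X i \in cs.
        by rewrite !mem_cat (map_f (fun B => 'X - \sum_(i in ~: B) X i)) ?orbT ?mem_enum.
      by rewrite diffE sumE vE subr_le0.
  rewrite !mem_cat => /or4P[/mapP[i _ ->]|/mapP[i]| |/mapP[B]].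
  - by rewrite linformN XE oppr_le0.
  - by rewrite mem_enum inE => iA ->; rewrite XE pA.
  - rewrite !inE => /orP[]/eqP ->; rewrite diffE sumE oneE p1 subrr //.
  - by rewrite mem_enum => BH ->; rewrite diffE sumE vE subr_le0 pH.
have [cs' cs'P] := @eliminate_variables R 2 n cs.
have PE v : P v <-> sat 2 cs' (fun i => if i == 0%N then 1 else v).
  rewrite -cs'P; split=> [[p pA pH]|[y [yx /csP]]].
    pose y i := if i is i'.+1 then
      if i' is j.+1 then odflt 0 (omap p (insub j)) else v else 1.
    exists y; split; first by case=> [|[|]].
    have yE : (fun i : 'I_n => y i.+2) = p.
      by apply/funext => i; rewrite /y valK.
    by apply/csP; rewrite // yE.
  by rewrite !yx // => /(_ erefl)[pA pH]; exists (fun i : 'I_n => y i.+2).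
have [|v [p pA pH]|q Pq qP] := @rational_max_line R cs' P 1 PE.
- exists 0, ind; last first.
    by move=> B _; apply: sumr_ge0 => i _; rewrite ler0n.
  split=> [i|i iA|]; rewrite /ind ?ler0n //.
    by case: eqP => // iE; rewrite iE a0A in iA.
  by rewrite (bigD1 a0) //= eqxx big1 ?addr0 // => i /negbTE ->.
- exact: le_trans (pH _ B0H) (mass_le1 _ _ pA).
exists q => // p pA; apply: contrapT => nB.
have [Bm BmH Bmin] := @arg_minP _ _ _ B0 (mem H) (fun B => mass p (~: B)) B0H.
have : P (mass p (~: Bm)) by exists p.
by move/qP => ?; apply: nB; exists Bm.
Qed.

End game_value.

(** * Maps with values in a simplex *)

Section essential_images.
Context {R : realType}.
Local Notation line := (lebesgue_line R).
Local Notation lambda := (@completed_lebesgue_measure R).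
Implicit Types (A B : set line).

(** The completed measure is the restriction of an outer measure, so monotonicity
and subadditivity hold for arbitrary sets; this spares proofs that the sets
where two maps differ are measurable. *)
Lemma lambda_mono A B : A `<=` B -> (lambda A <= lambda B)%E.
Proof. exact: (le_outer_measure (wlength idfun)^*%mu). Qed.

Lemma lambdaU2 A B : (lambda (A `|` B) <= lambda A + lambda B)%E.
Proof. exact: (outer_measureU2 (wlength idfun)^*%mu). Qed.

Lemma lambda_itv (a b : R) : a <= b -> lambda `[a, b[%classic = (b - a)%:E.
Proof.
move=> ab; transitivity (@lebesgue_measure R `[a, b[%classic) => //.
by rewrite lebesgue_measure_itv /= lte_fin; case: ltgtP ab => // ->; rewrite subrr.
Qed.

Lemma lambda_Omega : lambda (@Omega R) = 1%E.
Proof.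
transitivity (@lebesgue_measure R `[0, 1]%classic) => //.
by rewrite lebesgue_measure_itv /= lte_fin ltr01 oppr0 adde0.
Qed.

Lemma measurable_lebesgue_itv (i : interval R) :
  measurable ([set` i] : set line).
Proof. by apply: sub_caratheodory; exact: measurable_itv. Qed.

Lemma measurable_Omega : measurable (@Omega R).
Proof. exact: measurable_lebesgue_itv. Qed.

Lemma le_lambda_ae A B (P : line -> Prop) : {ae lambda, forall t, P t} ->
  (forall t, P t -> A t -> B t) -> (lambda A <= lambda B)%E.
Proof.
move=> [N [mN N0 PN]] AB.
have : A `<=` B `|` N.
  by move=> t At; have [Pt|nPt] := EM (P t); [left; exact: AB|right; exact: PN].
move=> /lambda_mono /le_trans; apply.
by apply: (le_trans (lambdaU2 _ _)); rewrite N0 adde0.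
Qed.

Context {S : Type}.
Implicit Types (f g : line -> S) (K : set (set S)).

Lemma lambda_fin_num f (C : set S) : lambda (@Omega R `&` f @^-1` C) \is a fin_num.
Proof.
rewrite ge0_fin_numE ?measure_ge0 //; apply: (@le_lt_trans _ _ 1%E).
  by rewrite -lambda_Omega; apply: lambda_mono => t [].
exact: ltry.
Qed.

Lemma lambda_preimage_sum n (e : 'I_n -> S) f (B : {set 'I_n}) :
  injective e -> measurable_map f ->
  lambda (@Omega R `&` f @^-1` (e @` [set` B])) =
  (\sum_(i in B) lambda (@Omega R `&` f @^-1` [set e i]))%E.
Proof.
move=> inje mf; rewrite -measure_bigsetU_ord_cond //; last first.
  by move=> i j _ _ [t [[_ /= fi] [_ /= fj]]]; apply: inje; rewrite -fi -fj.
congr (lambda _); rewrite -(@bigcup_pred _ _ (mem B)).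
rewrite predeqE => t; split=> [[Ot [i iB eif]]|[i iB [Ot eif]]].
  by exists i.
by split=> //; exists i.
Qed.

Lemma enum_finite_set (V : set S) : finite_set V ->
  exists n (e : 'I_n -> S), injective e /\ V = range e.
Proof.
move=> /finite_setP[n /card_set_bijP[r [rV rinj rsurj]]].
have /choice[e eP] (i : 'I_n) : exists s, V s /\ r s = i.
  by have [s Vs rs] := rsurj i (ltn_ord i); exists s.
exists n, e; split=> [i j eij|].
  by apply: val_inj; rewrite /= -(eP i).2 -(eP j).2 eij.
rewrite predeqE => s; split=> [Vs|[i _ <-]]; last exact: (eP i).1.
exists (Ordinal (rV s Vs)) => //; apply: rinj; rewrite ?inE //; first exact: (eP _).1.
exact: (eP _).2.
Qed.

(** The essential image of a map into [G] may be smaller than [G], but it is a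
nonempty subset of [G], hence a simplex: the vertices missing from it have null
preimages, and finitely many null sets cannot cover [Omega]. *)
Lemma L_of_map_into_simplex K (G : set S) g : simplicial_complex K -> K G ->
  measurable_map g -> (forall t, Omega t -> G (g t)) -> L K g.
Proof.
move=> [_ Kfin Ksub] KG mg gG.
have [n [e [inje GE]]] := enum_finite_set (Kfin G KG).1.
have imgG : ess_image g `<=` G.
  move=> s; rewrite /ess_image /=; apply: contraPP => nGs.
  rewrite (_ : _ `&` _ = set0) ?measure0 ?ltxx // -subset0 => t [Ot /= gs].
  by apply: nGs; rewrite -gs; exact: gG.
pose N := [set i | `[< ~ ess_image g (e i) >]]%SET.
have N0 : lambda (@Omega R `&` g @^-1` (e @` [set` N])) = 0%E.
  rewrite lambda_preimage_sum // big1 // => i; rewrite inE => /asboolP.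
  rewrite /ess_image /= => /negP; rewrite -leNgt => ei0.
  by apply/eqP; rewrite eq_le ei0 measure_ge0.
have aeg : {ae lambda, forall t, Omega t -> ess_image g (g t)}.
  exists (@Omega R `&` g @^-1` (e @` [set` N])); split=> // t /= /not_implyP[Ot ng].
  split=> //; move: (gG _ Ot); rewrite GE => -[i _ eig]; exists i => //=.
  by rewrite inE; apply/asboolP; rewrite eig.
split=> //; apply: Ksub KG imgG _; apply/set0P/negP => /eqP img0.
have : (lambda (@Omega R) <= lambda set0)%E.
  by apply: le_lambda_ae aeg _ => t /[apply]; rewrite img0.
by rewrite measure0 lambda_Omega lee_fin ler10.
Qed.

(** Keep [f] where it lies in [G] and send the rest to a fixed vertex of [G]:
the two maps then differ exactly where [f] is outside [G]. *)
Lemma exists_near_map K (G : set S) f : simplicial_complex K -> K G ->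
  measurable_map f ->
  exists2 g, L K g & dist_map f g = lambda (@Omega R `&` f @^-1` (~` G)).
Proof.
move=> cK KG mf; have [_ Kfin _] := cK.
have [s0 Gs0] := (Kfin G KG).2.
pose r s := if `[< G s >] then s else s0.
have rG s : G (r s) by rewrite /r; case: asboolP.
exists (r \o f).
  apply: (L_of_map_into_simplex cK KG) => [C|t _]; last exact: rG.
  by rewrite comp_preimage; exact: mf.
congr (lambda (_ `&` _)); rewrite predeqE => t /=; rewrite /r.
by case: asboolP => // nG; split=> // _ E; apply: nG; rewrite E.
Qed.

Lemma le_dist_map K f g : L K g ->
  (lambda (@Omega R `&` f @^-1` (~` ess_image g)) <= dist_map f g)%E.
Proof.
move=> [_ _ aeg]; apply: le_lambda_ae aeg _ => t tg [Ot nf]; split=> //= E.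
by apply: nf; rewrite E; exact: tg.
Qed.

End essential_images.

(** * Laws of maps on a labelled complex *)

Section laws.
Context {R : realType} {S : Type} {n : nat}.
Local Notation line := (lebesgue_line R).
Local Notation lambda := (@completed_lebesgue_measure R).
Implicit Types (f g : line -> S) (K : set (set S)) (e : 'I_n -> S)
  (k : {set {set 'I_n}}) (A B : {set 'I_n}).

(** The complex with combinatorial pattern [k] and vertices labelled by [e]. *)
Definition image_complex e k : set (set S) := [set e @` [set` A] | A in [set` k]].

Definition pullback e (G : set S) : {set 'I_n} := [set i | `[< G (e i) >]]%SET.

Definition law e f (i : 'I_n) : R := fine (lambda (@Omega R `&` f @^-1` [set e i])).

Lemma lambda_law e f B : injective e -> measurable_map f ->
  lambda (@Omega R `&` f @^-1` (e @` [set` B])) = (mass (law e f) B)%:E.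
Proof.
move=> inje mf; rewrite lambda_preimage_sum // /mass -sumEFin.
by apply: eq_bigr => i _; rewrite fineK ?lambda_fin_num.
Qed.

Lemma law_prob e k f : injective e -> L (image_complex e k) f ->
  exists2 A, A \in k & ess_image f = e @` [set` A] /\ prob_on A (law e f).
Proof.
move=> inje [mf [A kA AE] aef]; exists A => //; split=> //.
split=> [i|i iA|].
- exact/fine_ge0/measure_ge0.
- have : ~ ess_image f (e i).
    by rewrite -AE => -[j jA /inje ij]; move: iA; rewrite -ij; apply/negP/negPn.
  rewrite /ess_image /= => /negP; rewrite -leNgt => ei0.
  have -> // : law e f i = fine 0%E.
  by congr fine; apply/eqP; rewrite eq_le ei0 measure_ge0.
- apply: EFin_inj; have := @lambda_law e f [set: 'I_n]%SET inje mf.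
  rewrite /mass (eq_bigl xpredT) => [<-|i]; last by rewrite inE.
  rewrite -[RHS](@lambda_Omega R); apply/eqP; rewrite eq_le.
  rewrite lambda_mono /=; last by move=> t [].
  apply: le_lambda_ae aef _ => t tf Ot; split=> //.
  by have := tf Ot; rewrite -AE => -[i iA eif]; exists i; rewrite //= inE.
Qed.

(** The distance from [f] to the maps into [G] is read off the law of [f] and the
labels of the vertices lying in [G]. *)
Lemma lambda_outside e k f (G : set S) :
  injective e -> L (image_complex e k) f ->
  lambda (@Omega R `&` f @^-1` (~` G)) = (mass (law e f) (~: pullback e G))%:E.
Proof.
move=> inje Lf; have [A kA [AE _]] := law_prob inje Lf; have [mf _ aef] := Lf.
rewrite -lambda_law //; apply/eqP; rewrite eq_le; apply/andP; split.
  apply: le_lambda_ae aef _ => t tf [Ot nG]; split=> //.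
  have := tf Ot; rewrite AE => -[i _ ei]; exists i => //=.
  by rewrite !inE; apply/asboolPn; rewrite ei.
apply: lambda_mono => t [Ot [i iG ei]]; split=> //=; rewrite -ei.
by move: iG; rewrite /= !inE => /asboolPn.
Qed.

End laws.

(** * Realizing a probability vector as a law *)

Section realization.
Context {R : realType} {S : Type} {n : nat}.
Local Notation line := (lebesgue_line R).
Local Notation lambda := (@completed_lebesgue_measure R).

(** Lay intervals of lengths [p i] end to end and let [f] be [e i] on the [i]-th
one. The end point 1, which no interval contains, goes to an arbitrary vertex
[e a0] of the simplex. The lower bounds on the law are in fact equalities, both
sides having sum 1; this form is the one that bounds distances from below. *)
Lemma exists_map_of_prob (e : 'I_n -> S) (A : {set 'I_n}) (p : 'I_n -> R) :
  injective e -> prob_on A p ->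
  exists f : line -> S, [/\ measurable_map f,
    forall t, (e @` [set` A]) (f t) & forall i, p i <= law e f i].
Proof.
move=> inje [p0 pA p1].
have [a0 a0A] : exists a0, a0 \in A.
  apply/set0Pn/eqP => A0; move/eqP: p1; rewrite big1 ?(eq_sym 0) ?oner_eq0 // => i _.
  by rewrite pA // A0 inE.
pose s (a : 'I_n) : R := \sum_(j < n | (j < a)%N) p j.
pose I a : set line := `[s a, s a + p a[%classic.
have s_lt (a b : 'I_n) : (a < b)%N -> s a + p a <= s b.
  move=> ab; rewrite /s [leRHS](bigID (fun j : 'I_n => (j < a)%N)) /=.
  rewrite [X in _ <= X + _](eq_bigl (fun j : 'I_n => (j < a)%N)); last first.
    by move=> j; rewrite andbC; case: ltnP => //= ja; rewrite (ltn_trans ja ab).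
  rewrite lerD2l (bigD1 a) /= ?ltnn ?ab // lerDl.
  by apply: sumr_ge0.
have s0 a : 0 <= s a by apply: sumr_ge0.
have s1 a : s a + p a <= 1.
  rewrite -p1 (bigID (fun j : 'I_n => (j < a)%N)) /= lerD2l.
  by rewrite (bigD1 a) /= ?ltnn // lerDl; apply: sumr_ge0.
have I_inj a b t : I a t -> I b t -> a = b.
  rewrite /I /= !in_itv /= => /andP[sa ta] /andP[sb tb]; apply: val_inj => /=.
  case: (ltngtP a b) => // /s_lt le_s; exfalso.
    by have := lt_le_trans ta (le_trans le_s sb); rewrite ltxx.
  by have := lt_le_trans tb (le_trans le_s sa); rewrite ltxx.
have IA a t : I a t -> a \in A.
  move=> It; apply: contraT => /pA pa0; move: It.
  by rewrite /I /= in_itv /= pa0 addr0 => /andP[/le_lt_trans/[apply]]; rewrite ltxx.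
(* [code t] has at most one element; mapping it to a label through [h] makes
   the preimages of [f] finite unions of the measurable fibres of [code]. *)
pose h (X : {set 'I_n}) := odflt a0 [pick a in X].
pose code (t : line) := [set a | `[< I a t >]]%SET.
have mcode X : measurable (code @^-1` [set X]).
  rewrite (_ : _ @^-1` _ = \bigcap_(a in [set: 'I_n])
      (if a \in X then I a else ~` I a)).
    apply: fin_bigcap_measurable => [|a _]; first exact: finite_finset.
    case: ifP => _; last apply: measurableC; exact: measurable_lebesgue_itv.
  rewrite predeqE => t; split=> [/= <- a _|tX].
    by rewrite inE; case: asboolP.
  apply/setP => a; rewrite inE; have := tX a Logic.I.
  by case: ifP => _ ?; [apply/asboolP|apply/asboolPn].
exists (fun t => e (h (code t))); split=> [C|t|i].
- rewrite (_ : _ @^-1` C = \bigcup_(X in [set X | C (e (h X))]) code @^-1` [set X]).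
    apply: measurableI; first exact: measurable_Omega.
    by apply: fin_bigcup_measurable => [|X _]; [exact: finite_finset|exact: mcode].
  rewrite predeqE => t; split=> [Ct|[X CX /= tX]]; [by exists (code t)|by rewrite /= tX].
- exists (h (code t)) => //=; rewrite /h; case: pickP => //= a.
  by rewrite inE => /asboolP /IA.
have -> : p i = fine (lambda (I i)).
  by rewrite lambda_itv ?lerDl //= addrAC subrr add0r.
apply: fine_le; rewrite ?lambda_fin_num //.
  by rewrite lambda_itv ?lerDl.
apply: lambda_mono => t Iit; split.
  move: Iit; rewrite /I /Omega /= !in_itv /= => /andP[st ts].
  by rewrite (le_trans _ st) // (le_trans (ltW ts)).
rewrite /= /h; case: pickP => [a|] /=.
  by rewrite inE => /asboolP Iat; rewrite (I_inj _ _ _ Iat Iit).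
by move=> /(_ i); rewrite inE => /negP[]; apply/asboolP.
Qed.

End realization.

(** * Finiteness of the set of distances *)

Lemma ereal_inf_rational_values (R : realType) (I : finType) (v : I -> rat) (D : set (\bar R)) :
  D !=set0 -> (forall x, D x -> exists i, x = (ratr (v i))%:E) ->
  exists q : rat, ereal_inf D = (ratr q)%:E.
Proof.
move=> [x Dx] Dv; have [i0 xE] := Dv x Dx.
pose P i := `[< D (ratr (v i))%:E >].
have Pi0 : P i0 by apply/asboolP; rewrite -xE.
have [i /asboolP Pi imin] := @arg_minP _ _ _ i0 P v Pi0.
exists (v i); apply/eqP; rewrite eq_le; apply/andP; split.
  exact: ereal_inf_lbound.
apply: le_ereal_inf_tmp => y Dy; have [j yE] := Dv y Dy.
by rewrite yE lee_fin ler_rat; apply: imin; apply/asboolP; rewrite -yE.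
Qed.

Section complexes.
Context {S : Type}.
Implicit Types (K : set (set S)).

Lemma perm_complex_simplicial (s : S -> S) K :
  bijective s -> simplicial_complex K -> simplicial_complex (perm_complex s K).
Proof.
move=> [s' sK s'K] [[F KF] Kfin Ksub]; split.
- by exists (s @` F); exists F.
- move=> _ [G KG <-]; have [Gfin [x Gx]] := Kfin G KG.
  by split; [exact: finite_image|exists (s x); exists x].
- move=> _ G' [G KG <-] G'G [y G'y]; exists (s' @` G').
    apply: Ksub KG _ _; last by exists (s' y); exists y.
    by move=> _ [z /G'G[x Gx <-] <-]; rewrite sK.
  by rewrite image_comp (eq_imagel (f' := id)) ?image_id // => z _ /=; rewrite s'K.
Qed.

Lemma iso_class_refl K : iso_class K K.
Proof.
exists id => /=; first by exists id.
rewrite /perm_complex predeqE => F; split=> [[G KG <-]|KF]; first by rewrite image_id.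
by exists F; rewrite ?image_id.
Qed.

Lemma finite_complex_image K : simplicial_complex K -> finite_set K ->
  exists n (e : 'I_n -> S) k, injective e /\ K = image_complex e k.
Proof.
move=> [_ Kfin _] finK.
have [|n [e [inje VE]]] := @enum_finite_set _ (\bigcup_(F in K) F).
  by apply: bigcup_finite => // F /Kfin[].
exists n, e, [set A : {set 'I_n} | `[< K (e @` [set` A]) >]]%SET; split=> //.
rewrite predeqE => F; split=> [KF|[A /=]]; last by rewrite inE => /asboolP KA <-.
have FE : e @` [set` pullback e F] = F.
  rewrite predeqE => x; split=> [[i /=]|Fx].
    by rewrite inE => /asboolP Fi <-.
  have : range e x by rewrite -VE; exists F.
  by move=> [i _ eix]; exists i => //=; rewrite inE eix; apply/asboolP.
by exists (pullback e F) => //=; rewrite inE FE; apply/asboolP.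
Qed.

Lemma perm_image_complex n (s : S -> S) (e : 'I_n -> S) k :
  perm_complex s (image_complex e k) = image_complex (s \o e) k.
Proof.
rewrite /perm_complex /image_complex image_comp; apply: eq_imagel => A _ /=.
by rewrite image_comp.
Qed.

End complexes.

Section distance_values.
Context {R : realType} {S : Type}.
Implicit Types (K : set (set S)).

(** The simplices of [K] as seen from the vertices labelled by [e]. A trace may be
empty: a simplex of [K] may miss these vertices altogether. *)
Definition trace n (e : 'I_n -> S) K : {set {set 'I_n}} :=
  [set B | `[< (pullback e @` K) B >]]%SET.

(** The number [q] is chosen before [e] and [K]: since [H] ranges over a finite
type, [delta] takes finitely many values when the pattern [k] is fixed while
the labelling [e] and the complex [K] vary. It is the largest game value over
the simplices of [k]. *)
Lemma delta_rational n (k H : {set {set 'I_n}}) :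
  exists q : rat, forall (e : 'I_n -> S) K, injective e ->
    simplicial_complex (image_complex e k) -> simplicial_complex K ->
    trace e K = H -> @delta R S (image_complex e k) K = (ratr q)%:E.
Proof.
(* Patterns and trace families that no complex has: any [q] will do. *)
have [k0|[A0 A0k]] := set_0Vmem k.
  by exists 0 => e K _ [[F [A /=]]]; rewrite k0 inE.
have [H0|[B0 B0H]] := set_0Vmem H.
  exists 0 => e K _ _ [[G KG] _ _] HE; have : pullback e G \in H.
    by rewrite -HE inE; apply/asboolP; exists G.
  by rewrite H0 inE.
have [k0|k0] := boolP (finset.set0 \in k).
  exists 0 => e K _ [_ kfin _] _ _.
  have [_ [s [i /=]]] : finite_set (e @` [set` finset.set0 : {set 'I_n}]) /\
      e @` [set` finset.set0 : {set 'I_n}] !=set0 by apply: kfin; exists finset.set0.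
  by rewrite inE.
have Hn0 : H != finset.set0 by apply/set0Pn; exists B0.
have /choice[q qP] A : exists q : rat, A != finset.set0 ->
    (exists2 p : 'I_n -> R, prob_on A p & {in H, forall B, ratr q <= mass p (~: B)}) /\
    (forall p : 'I_n -> R, prob_on A p ->
       exists2 B, B \in H & mass p (~: B) <= ratr q).
  have [->|An0] := eqVneq A finset.set0; first by exists 0.
  by have [q ? ?] := @rational_game_value R n A H An0 Hn0; exists q.
have kn0 A : A \in k -> A != finset.set0 by apply: contraTneq => ->.
have [A Ak Amax] := @arg_maxP _ _ _ A0 (mem k) q A0k.
exists (q A) => e K inje ck cK HE; have [_ Kfin _] := cK.
apply/eqP; rewrite eq_le; apply/andP; split.
  apply: ge_ereal_sup => _ [f Lf <-].
  have [A1 A1k [_ pf]] := law_prob inje Lf.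
  have [B BH Bq] := (qP A1 (kn0 _ A1k)).2 _ pf.
  have : B \in trace e K by rewrite HE.
  rewrite inE => /asboolP[G KG GB].
  have [mf _ _] := Lf; have [g Lg fg] := exists_near_map cK KG mf.
  apply: ge_ereal_inf; exists (dist_map f g); first by exists g.
  rewrite fg (lambda_outside _ inje Lf) GB lee_fin (le_trans Bq) // ler_rat.
  exact: Amax.
have [[p pA pH] _] := qP A (kn0 _ Ak).
have [f [mf fA pf]] := exists_map_of_prob inje pA.
have Lf : L (image_complex e k) f.
  by apply: (L_of_map_into_simplex ck _ mf (fun t _ => fA t)); exists A.
apply: le_ereal_sup_tmp; eexists; first by exists f.
apply: le_ereal_inf_tmp => _ [g Lg <-].
apply: le_trans (le_dist_map f Lg); rewrite (lambda_outside _ inje Lf) lee_fin.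
apply: (@le_trans _ _ (mass p (~: pullback e (ess_image g)))).
  by apply: pH; rewrite -HE inE; apply/asboolP; exists (ess_image g) => //; case: Lg.
by apply: ler_sum => i _; exact: pf.
Qed.

End distance_values.

Theorem corollary4p2 (R : realType) (S : Type) (C1 C2 : set (set (set S))) :
  is_finite_iso_class C1 -> is_finite_iso_class C2 ->
  exists q : rat, dist_class R C1 C2 = (ratr q)%:E.
Proof.
move=> [K1 [cK1 fK1 ->]] [K2 [cK2 fK2 ->]].
have [n1 [e1 [k1 [inj1 K1E]]]] := finite_complex_image cK1 fK1.
have [n2 [e2 [k2 [inj2 K2E]]]] := finite_complex_image cK2 fK2.
have /choice[q1 q1P] := @delta_rational R S n1 k1.
have /choice[q2 q2P] := @delta_rational R S n2 k2.
pose v (H : {set {set 'I_n1}} * {set {set 'I_n2}}) := Num.max (q1 H.1) (q2 H.2).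
apply: (@ereal_inf_rational_values _ _ v).
  exists (dist_complex K1 K2), K1; first exact: iso_class_refl.
  by exists K2; first exact: iso_class_refl.
move=> _ [_ [s1 bs1 <-] [_ [s2 bs2 <-] <-]].
have c1 := perm_complex_simplicial bs1 cK1.
have c2 := perm_complex_simplicial bs2 cK2.
exists (trace (s1 \o e1) (perm_complex s2 K2), trace (s2 \o e2) (perm_complex s1 K1)).
have E1 : perm_complex s1 K1 = image_complex (s1 \o e1) k1.
  by rewrite K1E perm_image_complex.
have E2 : perm_complex s2 K2 = image_complex (s2 \o e2) k2.
  by rewrite K2E perm_image_complex.
rewrite /dist_complex /v /=.
have -> : delta (perm_complex s1 K1) (perm_complex s2 K2) =
    (ratr (q1 (trace (s1 \o e1) (perm_complex s2 K2))))%:E :> \bar R.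
  by rewrite {1}E1; apply: q1P; rewrite -?E1 //; exact: inj_comp (bij_inj bs1) inj1.
have -> : delta (perm_complex s2 K2) (perm_complex s1 K1) =
    (ratr (q2 (trace (s2 \o e2) (perm_complex s1 K1))))%:E :> \bar R.
  by rewrite {1}E2; apply: q2P; rewrite -?E2 //; exact: inj_comp (bij_inj bs2) inj2.
by rewrite -EFin_max /Order.max ltr_rat; case: ifP.
Qed.
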